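(* Let nine points $a,b,c,d,e,f,g,h,i$ in general linear position in $\mathbb{P}^2$ be given, with the five points $a,c,d,e,f$ on both a conic and a cubic, and the additional points $b,g,h,i$ on the cubic. Then the conic is $$\{x\in\mathbb{P}^2 : xaAa_1Bcx=0\},$$ where $A=de$, $B=fe$, and $a_1=af.dc$. The cubic has equation $$(xaAa_1\,.\,xbBkCb_1\,.\,xc)=0,$$ where the line $C$ and the points $k$, $b_1$ are constructed from the nine points as follows: $$g_1=gaAa_1.gc,\quad h_1=haAa_1.hc,\quad i_1=iaAa_1.ic,\qquad g_2=gbB,\quad h_2=hbB,\quad i_2=ibB,$$ $$C=ei_1,\quad u=h_1g_1Cg_2\,.\,fh_1,\quad v=g_1h_1Ch_2\,.\,fg_1,\quad K=uv,\quad k=K.i_1i_2,\quad b_1=kg_2Cg_1\,.\,kf .$$ Then the points $e$ and $f$ both lie on the auxiliary cubic $$(xa_1Aa\,.\,xb_1CkBb\,.\,xc)=0 .$$ Set $y$ equal to the third point of intersection of the line $ef$ with the auxiliary cubic. Then the point $$z=(yc\,.\,ya_1Aa)$$ (the meet of the lines $yc$ and $ya_1Aa$) lies on both the conic and the original cubic.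
   Context: Work in the projective plane $\mathbb{P}^2$. Points are nonzero vectors $[x_0:x_1:x_2]$ up to scaling; a line $L_0x_0+L_1x_1+L_2x_2=0$ is represented by its coefficient vector $[L_0:L_1:L_2]$ up to scaling. A zero point $[0:0:0]$ and a zero line $[0:0:0]$ are allowed as degenerate values. Lower case letters denote points, upper case letters denote lines. Points are in general linear position when no three of them lie on a line. The join of points $p,q$ is the line $pq:=p\times q$ (cross product), and the meet of lines $L,M$ is the point $LM:=L\times M$ (so $pp$ and $LL$ are zero). If $L$ is a line and $r$ a point, $Lr$ is a scalar that vanishes when $r$ lies on $L$. For three points, or three lines, the bracket is $(u.v.w)=u\cdot(v\times w)$; only its vanishing matters. Thus for lines $(L.M.R)=0$ iff the lines share a common point, two coincide, or one is the zero line. Expressions are evaluated from left to right, with periods (and parentheses) separating factors that are evaluated first: for example $xaAa_1$ is the line joining $a_1$ to the meet of the line $xa$ with $A$; $xbBkCb_1=((((xb)B)k)C)b_1$ is a line; $pq.rs$ denotes the meet of the lines $pq$ and $rs$; and $xaAa_1Bcx$ is the scalar obtained by pairing the line $((((xa)A)a_1)B)c$ with the point $x$. With fixed vector representatives, the left-hand sides of the displayed equations are homogeneous forms in $x$ of degree $2$ (the conic) and $3$ (the cubics). The third point of intersection of the line $ef$ with the auxiliary cubic is the intersection point remaining besides $e$ and $f$, intersections being counted with multiplicity.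
   Formalization: The clause that the cubic has the displayed equation is stated under the condition that the displayed form is not identically zero; it does vanish identically, for example, when i lies on the conic (then K = 0) or when the nine points are the base points of a pencil of cubics. *)

(* Defs.v *)
From HB Require Import structures.
From mathcomp Require Import all_boot all_order all_algebra.
From mathcomp Require Export mpoly.

Set Implicit Arguments.
Unset Strict Implicit.
Unset Printing Implicit Defensive.

Import GRing.Theory.
Local Open Scope ring_scope.

(* Points and lines of P^2 are both given by coordinate vectors 'rV_3, taken up
   to a nonzero scalar; the zero vector is the degenerate point or line. *)

Definition dot (R : comNzRingType) (u v : 'rV[R]_3) : R := (u *m v^T) 0 0.

Definition cross (R : comNzRingType) (u v : 'rV[R]_3) : 'rV[R]_3 :=
  \row_(j < 3) (u 0 (ordS j) * v 0 (ordS (ordS j))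
                - u 0 (ordS (ordS j)) * v 0 (ordS j)).

(* *v is both the join of two points and the meet of two lines.  It associates
   to the left, so x *v a *v A *v a1 is the expression written xaAa_1. *)
Notation "u *v w" := (cross u w) (at level 40, left associativity) : ring_scope.
Notation "u *d w" := (dot u w) (at level 40) : ring_scope.

Definition bracket (R : comNzRingType) (u v w : 'rV[R]_3) : R := u *d (v *v w).

(* A zero vector lies on a line with any two others, so this also forces the
   entries of s to be nonzero. *)
Definition general_position (F : fieldType) (s : seq 'rV[F]_3) : Prop :=
  forall i j k : nat, (i < j < k)%N -> (k < size s)%N ->
  ~ exists L : 'rV[F]_3,
      [/\ L != 0, L *d s`_i = 0, L *d s`_j = 0 & L *d s`_k = 0].

Definition curve (F : fieldType) (deg : nat) (G : {mpoly F[3]}) : Prop :=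
  G != 0 /\ G \is deg.-homog.

Definition on_curve (F : fieldType) (G : {mpoly F[3]}) (x : 'rV[F]_3) : Prop :=
  G.@[fun j => x 0 j] = 0.

(* E = 0 is an equation of the curve G: the two forms agree up to a nonzero
   scalar, and in particular have the same zeros. *)
Definition equation_of (F : fieldType) (G E : {mpoly F[3]}) : Prop :=
  exists2 l : F, l != 0 & E = l *: G.

Definition conic_lhs (R : comNzRingType) (a A a1 B c x : 'rV[R]_3) : R :=
  (x *v a *v A *v a1 *v B *v c) *d x.

Definition cubic_lhs (R : comNzRingType)
    (a A a1 b B k C b1 c x : 'rV[R]_3) : R :=
  bracket (x *v a *v A *v a1) (x *v b *v B *v k *v C *v b1) (x *v c).

Definition aux_lhs (R : comNzRingType)
    (a A a1 b B k C b1 c x : 'rV[R]_3) : R :=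
  bracket (x *v a1 *v A *v a) (x *v b1 *v C *v k *v B *v b) (x *v c).

(* To view a left-hand side as a form in x, it is evaluated over the polynomial
   ring at the generic point [X_0 : X_1 : X_2]. *)
Definition lift (F : fieldType) (v : 'rV[F]_3) : 'rV[{mpoly F[3]}]_3 :=
  map_mx (@mpolyC 3 F) v.

Definition generic_point (F : fieldType) : 'rV[{mpoly F[3]}]_3 :=
  \row_(j < 3) 'X_j.

Definition cubic_form (F : fieldType) (a A a1 b B k C b1 c : 'rV[F]_3) :
    {mpoly F[3]} :=
  cubic_lhs (lift a) (lift A) (lift a1) (lift b) (lift B) (lift k) (lift C)
            (lift b1) (lift c) (generic_point F).

Definition aux_form (F : fieldType) (a A a1 b B k C b1 c : 'rV[F]_3) :
    {mpoly F[3]} :=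
  aux_lhs (lift a) (lift A) (lift a1) (lift b) (lift B) (lift k) (lift C)
          (lift b1) (lift c) (generic_point F).

(* The form induced by G on the line ef, in the coordinates [X_0 : X_1] of the
   point X_0 e + X_1 f. *)
Definition restrict_to_line (F : fieldType) (G : {mpoly F[3]})
    (e f : 'rV[F]_3) : {mpoly F[2]} :=
  G \mPo [tuple e 0 j *: 'X_0 + f 0 j *: 'X_1 | j < 3].

(* The line ef is not contained in the cubic G and, counted with multiplicity,
   meets it in e, f and y: these are the zeros of 'X_1, 'X_0 and
   t *: 'X_0 - s *: 'X_1 respectively. *)
Definition third_point (F : fieldType) (G : {mpoly F[3]})
    (e f y : 'rV[F]_3) : Prop :=
  y != 0 /\
  exists s t l : F,
    [/\ y = s *: e + t *: f, l != 0
      & restrict_to_line G e f = l *: ('X_0 * 'X_1 * (t *: 'X_0 - s *: 'X_1))].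

(* Main.v *)
(** Let [tau x = xaAa_1 . xc]: the quadratic transformation with base points
    a, c, d, which fixes e and f.  Conics through a, c, d are exactly the forms
    [L . tau x] with [L] a fixed line; passing through e and f forces [L = ef],
    and [B . tau x] is the left-hand side of the conic.

    Likewise a cubic through a, c, d is [W x . tau x] with [W] a linear map from
    points to lines.  The lines [xaAa_1] and [xc] pass through [tau x], so they
    can be added to [W x] freely; if the cubic passes through b this is used to
    get [W b = 0].  Then [W x] depends only on the line xb, that is on the point
    [w = xbB] of ef, and a cubic through a, b, c, d is a linear map
    [w |-> lam w] from the line ef to lines, with equation
    [lam (xbB) . tau x = 0].  The six coefficients of [lam] are subject to one
    linear condition for each of e, f, g, h, i.  The construction of k and b_1
    produces a solution [lam w = wkCb_1], and whenever this solution is nonzero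
    the conditions are independent, so it is the only one up to a scalar.  In
    particular the constructed equation vanishes identically when the nine points
    are the base points of a pencil.

    The map [z y = yc . ya_1Aa] inverts [tau]: [tau (z y)] is a multiple [s y] of y.
    Substituting [z y] in the cubic equation gives [s] times the auxiliary form at y,
    and substituting it in the conic gives a multiple of [B . y], which vanishes
    on ef. *)

Require Import Defs.
From mathcomp Require Import all_boot all_order all_algebra.
From mathcomp Require Import ring.
Set Implicit Arguments.
Unset Strict Implicit.
Unset Printing Implicit Defensive.
Import GRing.Theory.
Local Open Scope ring_scope.

Local Notation o0 := (@Ordinal 3 0 isT).
Local Notation o1 := (@Ordinal 3 1 isT).
Local Notation o2 := (@Ordinal 3 2 isT).

(** * Coordinates and identities for cross and dot products *)

Section Vectors.
Variable R : comNzRingType.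
Implicit Types (u v w p q r : 'rV[R]_3) (x y z s : R).

Lemma rv3P u v : u 0 o0 = v 0 o0 -> u 0 o1 = v 0 o1 -> u 0 o2 = v 0 o2 -> u = v.
Proof.
move=> h0 h1 h2; apply/rowP => -[[|[|[|//]]] ltj].
- by rewrite (_ : Ordinal ltj = o0) //; apply: val_inj.
- by rewrite (_ : Ordinal ltj = o1) //; apply: val_inj.
- by rewrite (_ : Ordinal ltj = o2) //; apply: val_inj.
Qed.

Lemma cross0E u v : (u *v v) 0 o0 = u 0 o1 * v 0 o2 - u 0 o2 * v 0 o1.
Proof. by rewrite !mxE; congr (u _ _ * v _ _ - u _ _ * v _ _); apply: val_inj. Qed.

Lemma cross1E u v : (u *v v) 0 o1 = u 0 o2 * v 0 o0 - u 0 o0 * v 0 o2.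
Proof. by rewrite !mxE; congr (u _ _ * v _ _ - u _ _ * v _ _); apply: val_inj. Qed.

Lemma cross2E u v : (u *v v) 0 o2 = u 0 o0 * v 0 o1 - u 0 o1 * v 0 o0.
Proof. by rewrite !mxE; congr (u _ _ * v _ _ - u _ _ * v _ _); apply: val_inj. Qed.

Lemma dotE u v : u *d v = u 0 o0 * v 0 o0 + u 0 o1 * v 0 o1 + u 0 o2 * v 0 o2.
Proof.
rewrite /dot mxE !big_ord_recl big_ord0 addr0 !mxE addrA.
by congr (u _ _ * v _ _ + u _ _ * v _ _ + u _ _ * v _ _); apply: val_inj.
Qed.

Lemma addvE u v j : (u + v) 0 j = u 0 j + v 0 j. Proof. exact: mxE. Qed.
Lemma oppvE u j : (- u) 0 j = - u 0 j. Proof. exact: mxE. Qed.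
Lemma scalevE s u j : (s *: u) 0 j = s * u 0 j. Proof. exact: mxE. Qed.
Lemma zerovE j : (0 : 'rV[R]_3) 0 j = 0. Proof. exact: mxE. Qed.

Definition coordE :=
  (cross0E, cross1E, cross2E, dotE, addvE, oppvE, scalevE, zerovE).
End Vectors.

Ltac coords := rewrite /bracket; try (apply: rv3P); rewrite !coordE; ring.

Section VectorIdentities.
Variable R : comNzRingType.
Implicit Types (u v w p q r : 'rV[R]_3) (x y z s : R).

Lemma double_cross u v w : (u *v v) *v w = (u *d w) *: v - (v *d w) *: u.
Proof. by coords. Qed.

Lemma crossZl s u v : (s *: u) *v v = s *: (u *v v). Proof. by coords. Qed.
Lemma crossZr s u v : u *v (s *: v) = s *: (u *v v). Proof. by coords. Qed.
Lemma crossBl u v w : (u - v) *v w = u *v w - v *v w. Proof. by coords. Qed.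
Lemma dotZl s u v : (s *: u) *d v = s * (u *d v). Proof. by coords. Qed.
Lemma dotZr s u v : u *d (s *: v) = s * (u *d v). Proof. by coords. Qed.
Lemma dotBl u v w : (u - v) *d w = u *d w - v *d w. Proof. by coords. Qed.
Lemma dotDl u v w : (u + v) *d w = u *d w + v *d w. Proof. by coords. Qed.
Lemma dotC u v : u *d v = v *d u. Proof. by coords. Qed.
Lemma dot0l v : 0 *d v = 0. Proof. by coords. Qed.
Lemma dot_cross_l u v : u *d (u *v v) = 0. Proof. by coords. Qed.
Lemma dot_cross_r u v : v *d (u *v v) = 0. Proof. by coords. Qed.
Lemma cross_dot u v w : (u *v v) *d w = - (u *d (w *v v)). Proof. by coords. Qed.

(** The meet of the line [uv] with [w] stays on [uv], so joining it to [v] gives that line back. *)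
Lemma cross_back u v w : u *v v *v w *v v = - (v *d w) *: (u *v v). Proof. by coords. Qed.

End VectorIdentities.

(** * Coordinates of points and lines relative to three points *)

Section Frames.
Variables (R : comNzRingType) (p q r : 'rV[R]_3).
Implicit Types v : 'rV[R]_3.

(* The basis of lines used by [dual_frame] is dual to [p, q, r] only up to the
   factor [bracket p q r]. *)
Definition frame x y z := x *: p + y *: q + z *: r.
Definition dual_frame x y z := x *: (q *v r) + y *: (r *v p) + z *: (p *v q).

Local Notation P := frame.
Local Notation L := dual_frame.
Local Notation D := (bracket p q r).

Lemma frame_cross x y z x' y' z' :
  P x y z *v P x' y' z' = L (y * z' - z * y') (z * x' - x * z') (x * y' - y * x').
Proof. by rewrite /dual_frame /frame; coords. Qed.

Lemma dual_frame_cross x y z x' y' z' :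
  L x y z *v L x' y' z'
  = D *: P (y * z' - z * y') (z * x' - x * z') (x * y' - y * x').
Proof. by rewrite /dual_frame /frame; coords. Qed.

Lemma frameZ s x y z : s *: P x y z = P (s * x) (s * y) (s * z).
Proof. by rewrite /frame; coords. Qed.

Lemma dual_frameZ s x y z : s *: L x y z = L (s * x) (s * y) (s * z).
Proof. by rewrite /dual_frame; coords. Qed.

Lemma frameB x y z x' y' z' : P x y z - P x' y' z' = P (x - x') (y - y') (z - z').
Proof. by rewrite /frame; coords. Qed.

Lemma dual_frameB x y z x' y' z' :
  L x y z - L x' y' z' = L (x - x') (y - y') (z - z').
Proof. by rewrite /dual_frame; coords. Qed.

Lemma frame_dot x y z x' y' z' :
  P x y z *d L x' y' z' = D * (x * x' + y * y' + z * z').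
Proof. by rewrite /dual_frame /frame; coords. Qed.

Lemma dual_frame_dot x y z x' y' z' :
  L x y z *d P x' y' z' = D * (x * x' + y * y' + z * z').
Proof. by rewrite /dual_frame /frame; coords. Qed.

Definition framesE := (frameZ, dual_frameZ, frameB, dual_frameB, frame_dot,
  dual_frame_dot, frame_cross, dual_frame_cross).

Lemma frame_basis : [/\ P 1 0 0 = p, P 0 1 0 = q & P 0 0 1 = r].
Proof. by rewrite /frame; split; coords. Qed.

Lemma frame_dotl v x y z : P x y z *d v = x * (v *d p) + y * (v *d q) + z * (v *d r).
Proof. by rewrite /frame; coords. Qed.

Lemma dot_dual_frame v x y z :
  v *d L x y z = bracket v q r * x + bracket p v r * y + bracket p q v * z.
Proof. by rewrite /dual_frame; coords. Qed.

Lemma cramer v : D *: v = P (bracket v q r) (bracket p v r) (bracket p q v).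
Proof. by rewrite /frame; coords. Qed.

Lemma dual_cramer v : D *: v = L (v *d p) (v *d q) (v *d r).
Proof. by rewrite /dual_frame; coords. Qed.

Lemma cramer_coord v j :
  D * v 0 j
  = bracket v q r * p 0 j + bracket p v r * q 0 j + bracket p q v * r 0 j.
Proof. by rewrite -scalevE cramer /frame !mxE. Qed.
End Frames.

Lemma frame_crossl (R : comNzRingType) (p q r w : 'rV[R]_3) x y z :
  frame p q r x y z *v w = frame (p *v w) (q *v w) (r *v w) x y z.
Proof. by rewrite /frame; coords. Qed.

Section FieldFrames.
Variable F : fieldType.
Implicit Types p q r u v w : 'rV[F]_3.

Lemma frame_coord p q r v :
  bracket p q r != 0 -> exists x y z, v = frame p q r x y z.
Proof.
move=> d0; have := cramer p q r v; move/(congr1 ( *:%R (bracket p q r)^-1)).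
rewrite scalerA mulVf // scale1r frameZ => ->.
by do 3!eexists.
Qed.

Lemma dual_frame_coord p q r v : bracket p q r != 0 ->
  v = (bracket p q r)^-1 *: dual_frame p q r (v *d p) (v *d q) (v *d r).
Proof. by move=> d0; rewrite -dual_cramer scalerA mulVf // scale1r. Qed.

Lemma frame_eq0 p q r x y z : bracket p q r != 0 ->
  frame p q r x y z = 0 -> [/\ x = 0, y = 0 & z = 0].
Proof.
move=> D0 E.
have h l m n : x * l + y * m + z * n = 0.
  by apply: (mulfI D0); rewrite -frame_dot E mulr0 dot0l.
split; [have := h 1 0 0 | have := h 0 1 0 | have := h 0 0 1];
  by rewrite !(mulr0, mulr1, add0r, addr0).
Qed.

Lemma exists_dot_neq0 v : v != 0 -> exists w, w *d v != 0.
Proof. by move=> /rV0Pn [j vj]; exists (delta_mx 0 j); rewrite /dot -rowE !mxE. Qed.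

(** Complete [u], [v] to a basis by a vector [p]: the Cramer coefficient of [w] on [p] is
    [w *d (u *v v)], which vanishes. *)
Lemma dot_cross_eq0_span u v w :
  u *v v != 0 -> w *d (u *v v) = 0 -> exists s t, w = s *: u + t *: v.
Proof.
move=> /exists_dot_neq0 [p p0] w0.
have := cramer p u v w; rewrite {2}/bracket w0 /frame scale0r add0r => E.
exists ((bracket p u v)^-1 * bracket p w v), ((bracket p u v)^-1 * bracket p u w).
by rewrite -!scalerA -scalerDr -E scalerA mulVf ?scale1r.
Qed.

Lemma orthogonal_join p u v w : bracket p v u != 0 ->
  w *d u = 0 -> w *d v = 0 -> exists l, w = l *: (v *v u).
Proof.
move=> pvu wu wv; rewrite (dual_frame_coord w pvu) wu wv /dual_frame !scale0r !addr0.
by rewrite scalerA; eexists.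
Qed.
End FieldFrames.

(** * Linear maps from the points of the line ef to lines *)

(* The construction of k and b_1 computed in the basis [e, f, o] with [o = i_1];
   [g2], [h2], [i2] are arbitrary points of the line ef. *)
Section PencilCoordinates.
Variables (R : comNzRingType) (e f o : 'rV[R]_3).
Variables (x1 y1 z1 x2 y2 z2 a1 b1 a2 b2 a3 b3 : R).
Local Notation P := (frame e f o).
Local Notation L := (dual_frame e f o).
Local Notation d := (bracket e f o).

Let k0 := a1 * b2 * y2 * z1 - b1 * a2 * y1 * z2.
Let k1 := b1 * b2 * (z1 * y2 - y1 * z2).
Let k2 := b1 * a2 * y1 * x2 - a1 * b2 * y2 * x1.
Let l := b3 * k0 - a3 * k1.

Let E := P 1 0 0.
Let F := P 0 1 0.
Let O := P 0 0 1.
Let g1 := P x1 y1 z1.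
Let h1 := P x2 y2 z2.
Let g2 := a1 *: F - b1 *: E.
Let h2 := a2 *: F - b2 *: E.
Let i2 := a3 *: F - b3 *: E.
Let C := E *v O.
Let u := (h1 *v g1 *v C *v g2) *v (F *v h1).
Let v := (g1 *v h1 *v C *v h2) *v (F *v g1).
Let s := - d ^+ 4 * (z1 * y2 - y1 * z2) * (x1 * z2 - z1 * x2).

Lemma K_frame : u *v v = s *: L k0 k1 k2.
Proof.
rewrite /u /v /C /h2 /g2 /h1 /g1 /E /F /O !framesE.
congr dual_frame; rewrite /s /k0 /k1 /k2; ring.
Qed.

Lemma k_frame t :
  (t *: L k0 k1 k2) *v (O *v i2) = (d * t) *: P (b3 * k2) (- a3 * k2) (- l).
Proof.
rewrite /i2 /E /F /O !framesE.
by congr frame; rewrite /l /k0 /k1 /k2; ring.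
Qed.

(** For lines [L m0 0 m2] and [L 0 n1 n2] normalised by [m2 = b3] and [n2 = a3], the conditions at
    [g1] and [h1] form a linear system in [m0] and [n1]. Its determinant is [k2], and its Cramer
    numerators are [l] and [n]. *)
Let n := z1 * (a1 * b3 - b1 * a3) * a2 * x2 - a1 * x1 * z2 * (a2 * b3 - b2 * a3).
(* If the common factor [q] does not vanish, then neither does [k2], which is a
   determinant of the linear system solved by these two lines. *)
Lemma lam_frame t : let k := t *: P (b3 * k2) (- a3 * k2) (- l) in
  let b_1 := (k *v g2 *v C *v g1) *v (k *v F) in
  let q := d ^+ 3 * t ^+ 3 * a3 * k2 * b1 * y1 * l in
  F *v k *v C *v b_1 = q *: L l 0 (b3 * k2)
  /\ E *v k *v C *v b_1 = q *: L 0 n (a3 * k2).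
Proof.
rewrite /C /h1 /g2 /g1 /E /F /O !framesE.
split; congr dual_frame; rewrite /l /n /k0 /k1 /k2; ring.
Qed.
End PencilCoordinates.

(** When [e], [f], [o] are collinear they all lie on [C], and so does [k], a combination of [o] and
    a point of ef. Then (fk)C = (f.C)k - (k.C)f vanishes, and likewise with [e]. *)
Lemma lam_degenerate (R : comNzRingType) (e f o b K : 'rV[R]_3) (s t : R) :
  let C := e *v o in
  let k := K *v (o *v (s *: f - t *: e)) in
  bracket e f o = 0 -> f *v k *v C *v b = 0 /\ e *v k *v C *v b = 0.
Proof.
move=> C k d0.
have fC : f *d C = 0 by rewrite -oppr0 -d0 /C; coords.
have eC : e *d C = 0 by rewrite /C; coords.
have oC : o *d C = 0 by rewrite /C; coords.
have kC : k *d C = 0.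
  have -> : k *d C = (K *d (s *: f - t *: e)) * (o *d C)
                     - (K *d o) * (s * (f *d C) - t * (e *d C)).
    by rewrite /k; clear; move: C => C'; coords.
  by rewrite fC eC oC; ring.
rewrite !(double_cross _ k) fC eC kC !scale0r subr0.
by split; move: b => {}b; clear; coords.
Qed.

Section PencilUnique.
Variables (F : fieldType) (e f g1 h1 i1 g2 h2 i2 M N : 'rV[F]_3).
Variables (a1 b1 a2 b2 a3 b3 : F).
Hypotheses (g2E : g2 = a1 *: f - b1 *: e) (h2E : h2 = a2 *: f - b2 *: e)
  (i2E : i2 = a3 *: f - b3 *: e).
Let C := e *v i1.
Let u := (h1 *v g1 *v C *v g2) *v (f *v h1).
Let v := (g1 *v h1 *v C *v h2) *v (f *v g1).
Let K := u *v v.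
Let k := K *v (i1 *v i2).
Let b_1 := (k *v g2 *v C *v g1) *v (k *v f).

(* [M] and [N] are the values at [f] and [e] of a linear map from the points of
   the line ef to lines; the hypotheses say that it sends e, f, g_2, h_2, i_2 to
   lines through e, f, g_1, h_1, i_1. *)
Lemma pencil_unique :
  M *d f = 0 -> N *d e = 0 ->
  a1 * (M *d g1) = b1 * (N *d g1) ->
  a2 * (M *d h1) = b2 * (N *d h1) ->
  a3 * (M *d i1) = b3 * (N *d i1) ->
  f *v k *v C *v b_1 != 0 \/ e *v k *v C *v b_1 != 0 ->
  exists l, M = l *: (f *v k *v C *v b_1) /\ N = l *: (e *v k *v C *v b_1).
Proof.
move=> Mf Ne Eg Eh Ei nz.
(* For collinear [e], [f], [i1] both constructed lines vanish, against the last hypothesis;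
   otherwise the three points form a basis. *)
have [d0|d0] := eqVneq (bracket e f i1) 0.
  have := lam_degenerate b_1 K a3 b3 d0; rewrite -i2E => -[z1 z2].
  by case: nz => [/eqP[]|/eqP[]].
have [x1 [y1 [z1 g1E]]] := frame_coord g1 d0.
have [x2 [y2 [z2 h1E]]] := frame_coord h1 d0.
have [eE fE iE] := frame_basis e f i1.
have KE := K_frame e f i1 x1 y1 z1 x2 y2 z2 a1 b1 a2 b2.
have kE := k_frame e f i1 x1 y1 z1 x2 y2 z2 a1 b1 a2 b2 a3 b3.
have LE := lam_frame e f i1 x1 y1 z1 x2 y2 z2 a1 b1 a2 b2 a3 b3.
move: KE kE LE; rewrite eE fE iE -g1E -h1E; cbv zeta.
rewrite -g2E -h2E -i2E -/C -/u -/v -/K.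
set s0 := (X in X *: _); move=> KE.
move/(_ s0); rewrite -KE -/k => kE.
move/(_ (bracket e f i1 * s0)); rewrite -kE -/b_1.
pose k0 := a1 * b2 * y2 * z1 - b1 * a2 * y1 * z2.
pose k1 := b1 * b2 * (z1 * y2 - y1 * z2).
pose k2 := b1 * a2 * y1 * x2 - a1 * b2 * y2 * x1.
pose l := b3 * k0 - a3 * k1.
pose n := z1 * (a1 * b3 - b1 * a3) * a2 * x2 - a1 * x1 * z2 * (a2 * b3 - b2 * a3).
rewrite -/k0 -/k1 -/k2 -/l -/n.
set q := (X in X *: _); rewrite -/q; move=> [fL eL].
(* Both constructed lines are multiples of [q], so [q] is nonzero, and with it its factors [a3] and
   [k2]. *)
have q0 : q != 0.
  by apply/eqP => q0; case: nz; rewrite ?fL ?eL q0 scale0r eqxx.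
have : (a3 != 0) /\ (k2 != 0).
  by split; apply: contraNneq q0 => z; rewrite /q z; apply/eqP; ring.
move=> [a30 k20].
set m0 := M *d e; set m2 := M *d i1; set n1 := N *d f; set n2 := N *d i1.
set d := bracket e f i1 in d0 *.
have ME : M = d^-1 *: dual_frame e f i1 m0 0 m2.
  by rewrite {1}(dual_frame_coord M d0) Mf.
have NE : N = d^-1 *: dual_frame e f i1 0 n1 n2.
  by rewrite {1}(dual_frame_coord N d0) Ne.
have Ld x y z x' y' z' := dual_frame_dot e f i1 x y z x' y' z'.
have Eg' : a1 * (m0 * x1 + m2 * z1) = b1 * (n1 * y1 + n2 * z1).
  move: Eg; rewrite ME NE g1E.
  rewrite !dual_frameZ !Ld -/d => Eg.
  transitivity (a1 * (d * (d^-1 * m0 * x1 + d^-1 * 0 * y1 + d^-1 * m2 * z1))).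
    by field.
  by rewrite Eg; field.
have Eh' : a2 * (m0 * x2 + m2 * z2) = b2 * (n1 * y2 + n2 * z2).
  move: Eh; rewrite ME NE h1E.
  rewrite !dual_frameZ !Ld -/d => Eh.
  transitivity (a2 * (d * (d^-1 * m0 * x2 + d^-1 * 0 * y2 + d^-1 * m2 * z2))).
    by field.
  by rewrite Eh; field.
(* The condition at [i1] makes [(m2, n2)] equal to [s] times [(b3, a3)]. The conditions at [g1] and
   [h1] then give [m0] and [n1] by Cramer's rule with determinant [k2]. *)
pose s := n2 / a3.
have n2E : n2 = a3 * s by rewrite /s; field.
have m2E : m2 = b3 * s by apply: (mulfI a30); rewrite Ei -/n2 n2E; ring.
have m0E : k2 * m0 = s * l.
  rewrite m2E n2E in Eg' Eh'.
  have -> : k2 * m0 = b1 * y1 * (a2 * (m0 * x2 + b3 * s * z2))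
     - b2 * y2 * (a1 * (m0 * x1 + b3 * s * z1))
     + b3 * s * (b2 * y2 * a1 * z1 - b1 * y1 * a2 * z2) by rewrite /k2; ring.
  by rewrite Eg' Eh' /l /k0 /k1; ring.
have n1E : k2 * n1 = s * n.
  rewrite m2E n2E in Eg' Eh'.
  have -> : k2 * n1 = a2 * x2 * (b1 * (n1 * y1 + a3 * s * z1))
     - a1 * x1 * (b2 * (n1 * y2 + a3 * s * z2))
     + a3 * s * (a1 * x1 * b2 * z2 - a2 * x2 * b1 * z1) by rewrite /k2; ring.
  by rewrite -Eg' -Eh' /n; ring.
clearbody s m0 m2 n1 n2 q k2 l n d.
(* The coordinates differ by the factor [s / k2]; [d^-1] is the scalar in front of [M] and [N], and
   [q] the one in front of the constructed lines. *)
exists (d^-1 * (s / (k2 * q))).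
have qE : d^-1 * (s / (k2 * q)) * q = d^-1 * (s / k2).
  by rewrite invfM !mulrA divfK.
rewrite fL eL !scalerA qE ME NE !dual_frameZ m2E n2E.
rewrite (_ : m0 = s * l / k2); last by rewrite -m0E; field.
rewrite (_ : n1 = s * n / k2); last by rewrite -n1E; field.
by split; congr dual_frame; field; rewrite ?d0 ?k20.
Qed.
End PencilUnique.

(** * Ring morphisms commute with joins, meets and brackets *)

Section Morphism.
Variables (R S : comNzRingType) (phi : {rmorphism R -> S}).
Implicit Types u v w : 'rV[R]_3.

Lemma map_cross u v : map_mx phi (u *v v) = map_mx phi u *v map_mx phi v.
Proof. by apply/rowP => j; rewrite !mxE rmorphB !rmorphM. Qed.

Lemma map_dot u v : phi (u *d v) = map_mx phi u *d map_mx phi v.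
Proof. by rewrite !dotE !rmorphD !rmorphM !mxE. Qed.

Lemma map_bracket u v w :
  phi (bracket u v w) = bracket (map_mx phi u) (map_mx phi v) (map_mx phi w).
Proof. by rewrite /bracket map_dot map_cross. Qed.
End Morphism.

(** * Forms expanded in three linear forms [X], [Y], [Z] *)

Section Forms.
Variables (F : fieldType) (X Y Z : {mpoly F[3]}).

(** Forms of degree [n] in [X], [Y], [Z]. The recursion splits off one factor at a time, so that in
    low degree destructuring exhibits all coefficients. *)
Fixpoint spanned n (p : {mpoly F[3]}) : Prop :=
  if n is n'.+1 then exists p0 p1 p2, [/\ spanned n' p0, spanned n' p1, spanned n' p2
     & p = X * p0 + Y * p1 + Z * p2]
  else exists s, p = s%:MP.

Lemma spanned0 n : spanned n 0.
Proof.
elim: n => [|n IH] /=; first by exists 0.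
by exists 0, 0, 0; split=> //; rewrite !mulr0 !addr0.
Qed.

Lemma spannedD n p q : spanned n p -> spanned n q -> spanned n (p + q).
Proof.
elim: n p q => [|n IH] p q /=.
  by move=> [s ->] [t ->]; exists (s + t); rewrite mpolyCD.
move=> [p0 [p1 [p2 [h0 h1 h2 ->]]]] [q0 [q1 [q2 [k0 k1 k2 ->]]]].
exists (p0 + q0), (p1 + q1), (p2 + q2); split; try exact: IH.
ring.
Qed.

Lemma spannedZ n s p : spanned n p -> spanned n (s *: p).
Proof.
elim: n p => [|n IH] p /=.
  by move=> [t ->]; exists (s * t); rewrite -mul_mpolyC mpolyCM.
move=> [p0 [p1 [p2 [h0 h1 h2 ->]]]].
exists (s *: p0), (s *: p1), (s *: p2); split; try exact: IH.
by rewrite !scalerDr !scalerAr.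
Qed.

Hypothesis spanX : forall j, exists s t u : F, 'X_j = s *: X + t *: Y + u *: Z.

(** Induction on the degree: one variable is split off the monomial and rewritten by [spanX]. *)
Lemma spannedX n m : mdeg m = n -> spanned n 'X_[m].
Proof.
elim: n m => [|n IH] m /=.
  by move/eqP; rewrite mdeg_eq0 => /eqP ->; exists 1; rewrite mpolyX0.
move=> degm.
have [i mi] : exists i, (0 < m i)%N.
  apply/existsP; move/eqP: degm; apply: contraLR => /existsPn m0.
  by rewrite mdegE big1 // => i _; apply/eqP; rewrite -leqn0 leqNgt.
have Um : (U_(i) <= m)%MM by rewrite lep1mP -lt0n.
have {}degm : mdeg (m - U_(i))%MM = n.
  by move: degm; rewrite -{1}(submK Um) mdegD mdeg1 addn1 => -[].
rewrite -(submK Um) mpolyXD; have {}IH := IH _ degm.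
have [s [t [u ->]]] := spanX i.
exists (s *: 'X_[m - U_(i)]), (t *: 'X_[m - U_(i)]), (u *: 'X_[m - U_(i)]).
split; try exact: spannedZ.
by rewrite -!mul_mpolyC; ring.
Qed.

Lemma homog_spanned n p : p \is n.-homog -> spanned n p.
Proof.
move=> /dhomogP homp; rewrite (mpolyE p).
elim: (msupp p) homp => [|m s IH] homp; first by rewrite big_nil; apply: spanned0.
rewrite big_cons; apply: spannedD.
  by apply/spannedZ/spannedX; apply: homp; rewrite mem_head.
by apply: IH => m' m's; apply: homp; rewrite inE m's orbT.
Qed.
End Forms.

(** With the points as columns, a vanishing bracket yields a vector in the left kernel, that is, a
    line through the three points. *)
Lemma bracket_det (R : comNzRingType) (p q r : 'rV[R]_3) :
  \det (\matrix_(i < 3, j < 3) nth p [:: p; q; r] j 0 i) = bracket p q r.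
Proof.
rewrite (expand_det_col _ ord0) !big_ord_recl big_ord0 /cofactor.
rewrite !(expand_det_row _ ord0) !big_ord_recl !big_ord0 /cofactor !det_mx11 !mxE /=.
rewrite /bracket !coordE.
have -> : lift ord0 ord0 = o1 by apply: val_inj.
have -> : lift ord0 (lift ord0 ord0) = o2 by apply: val_inj.
have -> : lift o1 ord0 = o0 by apply: val_inj.
have -> : lift o1 (lift ord0 0) = o2 by apply: val_inj.
have -> : lift o2 ord0 = o0 by apply: val_inj.
have -> : lift o2 (lift ord0 0) = o1 by apply: val_inj.
have -> : ord0 = o0 :> 'I_3 by apply: val_inj.
rewrite /bump /=; ring.
Qed.

Lemma bracket_neq0 (F : fieldType) (p q r : 'rV[F]_3) :
  (~ exists L : 'rV[F]_3, [/\ L != 0, L *d p = 0, L *d q = 0 & L *d r = 0]) ->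
  bracket p q r != 0.
Proof.
move=> h; rewrite -bracket_det; apply/det0P => -[L L0 Lz]; apply: h; exists L.
have Le (j : 'I_3) : L *d nth p [:: p; q; r] j = 0.
  have := congr1 (fun M : 'rV[F]_3 => M 0 j) Lz; rewrite !mxE => <-.
  by rewrite /dot mxE; apply: eq_bigr => i _; rewrite !mxE.
by split=> //; [apply: (Le o0) | apply: (Le o1) | apply: (Le o2)].
Qed.

Section FormsAt.
Variables (F : fieldType) (X Y Z : {mpoly F[3]}).
Hypothesis spanX : forall j, exists s t u : F, 'X_j = s *: X + t *: Y + u *: Z.
Variables (p0 p1 p2 : 'I_3 -> F).
Hypothesis at0 : [/\ X.@[p0] != 0, Y.@[p0] = 0 & Z.@[p0] = 0].
Hypothesis at1 : [/\ X.@[p1] = 0, Y.@[p1] != 0 & Z.@[p1] = 0].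
Hypothesis at2 : [/\ X.@[p2] = 0, Y.@[p2] = 0 & Z.@[p2] != 0].

(** At each of the three points only one of the squares of [X], [Y], [Z] survives, so the three
    squares have coefficient zero. *)
Lemma conic_through_frame Q : Q \is 2.-homog ->
  Q.@[p0] = 0 -> Q.@[p1] = 0 -> Q.@[p2] = 0 ->
  exists s t u : F, Q = s%:MP * (Y * Z) + t%:MP * (X * Z) + u%:MP * (X * Y).
Proof.
move=> /(homog_spanned spanX) /= [q0 [q1 [q2 [[r0 [r1 [r2 [[s0 ->] [s1 ->] [s2 ->] ->]]]]
  [u0 [u1 [u2 [[t0 ->] [t1 ->] [t2 ->] ->]]]]
  [v0 [v1 [v2 [[w0 ->] [w1 ->] [w2 ->] ->]]]] ->]]]].
case: at0 at1 at2 => [X0 Y0 Z0] [X1 Y1 Z1] [X2 Y2 Z2].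
rewrite !(mevalD, mevalM, mevalC, Y0, Z0, X1, Z1, X2, Y2, mul0r, mulr0, addr0, add0r).
move=> /eqP; rewrite !mulf_eq0 !(negPf X0) /= => /eqP s00.
move=> /eqP; rewrite !mulf_eq0 !(negPf Y1) /= => /eqP t10.
move=> /eqP; rewrite !mulf_eq0 !(negPf Z2) /= => /eqP w20.
exists (t2 + w1), (s2 + w0), (s1 + t0); rewrite s00 t10 w20 !mpolyCD mpolyC0; ring.
Qed.

(** The three cubes drop out as the squares do for conics, and every other monomial is divisible by
    a product of two distinct forms among [X], [Y], [Z]. *)
Lemma cubic_through_frame G : G \is 3.-homog ->
  G.@[p0] = 0 -> G.@[p1] = 0 -> G.@[p2] = 0 ->
  exists l0 l1 l2, [/\ spanned X Y Z 1 l0, spanned X Y Z 1 l1, spanned X Y Z 1 l2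
    & G = l0 * (Y * Z) + l1 * (X * Z) + l2 * (X * Y)].
Proof.
move=> /(homog_spanned spanX) /= [? [? [?
  [[? [? [? [
   [? [? [? [[s000 ->] [s001 ->] [s002 ->] ->]]]]
   [? [? [? [[s010 ->] [s011 ->] [s012 ->] ->]]]]
   [? [? [? [[s020 ->] [s021 ->] [s022 ->] ->]]]] ->]]]]
  [? [? [? [
   [? [? [? [[s100 ->] [s101 ->] [s102 ->] ->]]]]
   [? [? [? [[s110 ->] [s111 ->] [s112 ->] ->]]]]
   [? [? [? [[s120 ->] [s121 ->] [s122 ->] ->]]]] ->]]]]
  [? [? [? [
   [? [? [? [[s200 ->] [s201 ->] [s202 ->] ->]]]]
   [? [? [? [[s210 ->] [s211 ->] [s212 ->] ->]]]]
   [? [? [? [[s220 ->] [s221 ->] [s222 ->] ->]]]] ->]]]] ->]]]].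
case: at0 at1 at2 => [X0 Y0 Z0] [X1 Y1 Z1] [X2 Y2 Z2].
rewrite !(mevalD, mevalM, mevalC, Y0, Z0, X1, Z1, X2, Y2, mul0r, mulr0, addr0, add0r).
move=> /eqP; rewrite !mulf_eq0 !(negPf X0) /= => /eqP ->.
move=> /eqP; rewrite !mulf_eq0 !(negPf Y1) /= => /eqP ->.
move=> /eqP; rewrite !mulf_eq0 !(negPf Z2) /= => /eqP ->.
pose C (s : F) := s%:MP_[3].
(* The monomial [XYZ] is divisible by all three products; it is assigned to the first, whence the
   zero coefficients in the other two. *)
exists (X * C (s012 + s021 + s102 + s120 + s201 + s210)
        + Y * C (s112 + s121 + s211) + Z * C (s122 + s212 + s221)).
exists (X * C (s002 + s020 + s200) + Y * C 0 + Z * C (s022 + s202 + s220)).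
exists (X * C (s001 + s010 + s100) + Y * C (s011 + s101 + s110) + Z * C 0).
split.
- by do 3!eexists; split; last reflexivity; eexists; reflexivity.
- by do 3!eexists; split; last reflexivity; eexists; reflexivity.
- by do 3!eexists; split; last reflexivity; eexists; reflexivity.
by rewrite /C !mpolyCD !mpolyC0; ring.
Qed.
End FormsAt.

(* [lift] would otherwise denote [fintype.lift]. *)
Local Notation lift := Defs.lift.

(** * The transformation [tau], its inverse, and the auxiliary cubic *)

Section Tau.
Variable R : comNzRingType.
Implicit Types a b c e f k A B C u v w x y : 'rV[R]_3.

Definition tau (a A a1 c x : 'rV[R]_3) := (x *v a *v A *v a1) *v (x *v c).

Lemma tauZ a A a1 c x s :
  tau a A a1 c (s *: x) = s ^+ 2 *: tau a A a1 c x.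
Proof. by rewrite /tau !crossZl !crossZr scalerA. Qed.

Lemma tau_frame a c d (e0 e1 e2 f0 f1 f2 x y z : R) :
  let P := frame a c d in
  let e := P e0 e1 e2 in
  let f := P f0 f1 f2 in
  tau a (d *v e) ((a *v f) *v (d *v c)) c (P x y z)
  = bracket a c d ^+ 3
    *: P (e0 * f2 * (x * y))
         (e0 * f1 * (y * z) + e1 * f2 * (x * y) - e1 * f1 * (x * z))
         (e0 * f2 * (y * z)).
Proof.
have [aE cE dE] := frame_basis a c d; cbv zeta.
(* Once [a], [c], [d] are themselves written in frame coordinates, [framesE] evaluates the whole
   construction. *)
suff : let P := frame a c d in
  let e := P e0 e1 e2 in
  let f := P f0 f1 f2 in
  tau (P 1 0 0) (P 0 0 1 *v e) ((P 1 0 0 *v f) *v (P 0 0 1 *v P 0 1 0)) (P 0 1 0)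
    (P x y z)
  = bracket a c d ^+ 3
    *: P (e0 * f2 * (x * y))
         (e0 * f1 * (y * z) + e1 * f2 * (x * y) - e1 * f1 * (x * z))
         (e0 * f2 * (y * z)).
  by cbv zeta; rewrite aE cE dE.
by rewrite /tau !framesE; congr frame; ring.
Qed.

Lemma conic_lhs_tau a A a1 B c x :
  conic_lhs a A a1 B c x = B *d tau a A a1 c x.
Proof. by rewrite /conic_lhs /tau; move: (_ *v a1) => p; rewrite cross_dot; coords. Qed.

(** The coordinates of xbB on ef are linear in [x]. At g, h, i they supply the scalars [a1], [b1],
    [a2], [b2], [a3], [b3] of the pencil. *)
Lemma join_meet e f b x :
  x *v b *v (f *v e) = bracket x b e *: f - bracket x b f *: e.
Proof. by coords. Qed.

Lemma cubic_lhs_tau a A a1 b e f k C b1 c x :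
  cubic_lhs a A a1 b (f *v e) k C b1 c x =
  - ((bracket x b e *: (f *v k *v C *v b1) - bracket x b f *: (e *v k *v C *v b1))
     *d tau a A a1 c x).
Proof.
rewrite /cubic_lhs join_meet !crossBl !crossZl /tau.
by move: (_ *v a1) (_ - _) (x *v c) => p q r; coords.
Qed.

(* The point z of the statement, as a function of y. *)
Definition aux_point a A a1 c y := (y *v c) *v (y *v a1 *v A *v a).

Definition tau_aux_scale a A a1 c y :=
  - ((y *v a1 *v A *v a) *d c) * ((y *v c) *d a) * (a *d A) * (A *d a1) * bracket y a1 c.

(** With z the auxiliary point, [tau] retraces its construction: za is the line ya_1Aa, which meets
    [A] in ya_1A; joining to [a1] gives back ya_1, and this meets zc = yc in [y]. Each step
    contributes one scalar. *)
Lemma tau_aux_point a A a1 c y :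
  tau a A a1 c (aux_point a A a1 c y) = tau_aux_scale a A a1 c y *: y.
Proof.
rewrite /tau /aux_point !(double_cross (y *v c)).
have -> : (y *v a1 *v A *v a) *d a = 0 by rewrite dotC dot_cross_r.
have -> : (y *v c) *d c = 0 by rewrite dotC dot_cross_r.
rewrite !scale0r subr0 sub0r crossZl.
have -> : y *v a1 *v A *v a *v A = - (a *d A) *: (y *v a1 *v A).
  by rewrite double_cross dotC dot_cross_r scale0r sub0r scaleNr.
rewrite !crossZl.
have -> : y *v a1 *v A *v a1 = - (A *d a1) *: (y *v a1).
  by rewrite double_cross dotC dot_cross_r scale0r sub0r scaleNr.
rewrite -scaleNr crossZr !crossZl (double_cross y a1 (y *v c)) dot_cross_l scale0r sub0r.
have -> : a1 *d (y *v c) = - bracket y a1 c by coords.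
rewrite !scaleNr !scalerN !opprK !scalerA /tau_aux_scale -?scaleNr.
by congr (_ *: _); ring.
Qed.

(** The cubic at [z] pairs the line zbBkCb_1 with [tau z], a multiple of [y]. Moving [b1], [C], [k],
    [B], [b] one by one to the other side of the pairing gives [z] against yb_1CkBb, which is the
    auxiliary form. *)
Lemma cubic_aux_point a A a1 b B k C b1 c y :
  cubic_lhs a A a1 b B k C b1 c (aux_point a A a1 c y)
  = tau_aux_scale a A a1 c y * aux_lhs a A a1 b B k C b1 c y.
Proof.
set z := aux_point _ _ _ _ _.
have -> : cubic_lhs a A a1 b B k C b1 c z =
  - ((z *v b *v B *v k *v C *v b1) *d tau a A a1 c z).
  by rewrite /cubic_lhs /tau; move: (_ *v a1) (_ *v b1) (z *v c) => p q r; coords.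
rewrite tau_aux_point dotZr -mulrN; congr (_ * _).
rewrite cross_dot opprK 2!cross_dot opprK 2!cross_dot opprK.
rewrite /z /aux_point /aux_lhs.
by move: (_ *v a) (_ *v b) (_ *v c) => p q r; coords.
Qed.

(** As [e] lies on [A], [B] and [C], every meet with one of them returns [e] up to a scalar; the
    three lines become ea, eb, ec. *)
Lemma aux_lhs_e a A a1 b B k C b1 c e : e *d A = 0 -> e *d B = 0 -> e *d C = 0 ->
  aux_lhs a A a1 b B k C b1 c e = 0.
Proof.
move=> eA eB eC; rewrite /aux_lhs.
rewrite (double_cross e a1) eA scale0r sub0r.
rewrite (double_cross e b1) eC scale0r sub0r -!scaleNr !crossZl.
rewrite (double_cross e k) eB scale0r sub0r -!scaleNr !crossZl.
by move: (- _) (- _) (- _) => p q r; coords.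
Qed.

(** Here [a1] lies on af and [b1] on kf, so fa_1Aa retraces the line fa and fb_1Ck the line fk. The
    latter meets [B] in [f], so the three lines become fa, fb, fc. *)
Lemma aux_lhs_f a A b B k C c f p q : f *d B = 0 ->
  aux_lhs a A ((a *v f) *v p) b B k C (q *v (k *v f)) c f = 0.
Proof.
move=> fB; rewrite /aux_lhs.
have -> : f *v (a *v f *v p) = - (f *d p) *: (f *v a).
  by rewrite double_cross; coords.
have -> : f *v (q *v (k *v f)) = (q *d f) *: (f *v k) by coords.
rewrite !crossZl !cross_back !crossZl (double_cross f k) fB scale0r sub0r -scaleNr !crossZl.
rewrite !scalerA; move: (_ * _) (_ * _) => s t.
by coords.
Qed.

End Tau.

(** Cramer's rule gives the frame coordinates of [D *: x], and [tau] is quadratic, hence the factor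
    [D ^+ 2]. It stays on both sides because [R] is only a ring, and is cancelled later over a
    domain. *)
Lemma tau_dot (R : comNzRingType) (a c d x : 'rV[R]_3) e0 e1 e2 f0 f1 f2 l m n :
  let e := frame a c d e0 e1 e2 in
  let f := frame a c d f0 f1 f2 in
  let X := bracket x c d in
  let Y := bracket a x d in
  let Z := bracket a c x in
  let D := bracket a c d in
  D ^+ 2 * (tau a (d *v e) ((a *v f) *v (d *v c)) c x *d dual_frame a c d l m n)
  = D ^+ 2 * (D ^+ 2 * (e0 * f2 * (X * Y) * l
     + (e0 * f1 * (Y * Z) + e1 * f2 * (X * Y) - e1 * f1 * (X * Z)) * m
     + e0 * f2 * (Y * Z) * n)).
Proof.
move=> e f X Y Z D; rewrite -dotZl -tauZ /D cramer -/X -/Y -/Z -/D.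
rewrite tau_frame -/D.
by rewrite dotZl frame_dot -/D; move: X Y Z D => X Y Z D; ring.
Qed.

Lemma aux_point_frame (R : comNzRingType) (a c d : 'rV[R]_3) e0 e1 e2 f0 f1 f2 x y z :
  let e := frame a c d e0 e1 e2 in
  let f := frame a c d f0 f1 f2 in
  let w := (y * f2 - z * f1) * e0 - x * f2 * e1 in
  aux_point a (d *v e) ((a *v f) *v (d *v c)) c (frame a c d x y z)
  = (- bracket a c d ^+ 3)
    *: frame a c d (- (x * w)) (x * z * f1 * e1) (- (z * w)).
Proof.
have [aE cE dE] := frame_basis a c d; cbv zeta.
suff : let P := frame a c d in
  let e := P e0 e1 e2 in
  let f := P f0 f1 f2 in
  let w := (y * f2 - z * f1) * e0 - x * f2 * e1 in
  aux_point (P 1 0 0) (P 0 0 1 *v e) ((P 1 0 0 *v f) *v (P 0 0 1 *v P 0 1 0))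
    (P 0 1 0) (P x y z)
  = (- bracket a c d ^+ 3) *: P (- (x * w)) (x * z * f1 * e1) (- (z * w)).
  by cbv zeta; rewrite aE cE dE.
by rewrite /aux_point !framesE; congr frame; ring.
Qed.

(** * Evaluation of forms at points and lifting of constants *)

Section MorphismForms.
Variables (R S : comNzRingType) (phi : {rmorphism R -> S}).
Implicit Types a b c k x y A B C M N t : 'rV[R]_3.

Lemma map_tau a A a1 c x :
  map_mx phi (tau a A a1 c x)
  = tau (map_mx phi a) (map_mx phi A) (map_mx phi a1) (map_mx phi c) (map_mx phi x).
Proof. by rewrite /tau !map_cross. Qed.

Lemma map_cubic_lhs a A a1 b B k C b1 c x :
  phi (cubic_lhs a A a1 b B k C b1 c x)
  = cubic_lhs (map_mx phi a) (map_mx phi A) (map_mx phi a1) (map_mx phi b) (map_mx phi B)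
      (map_mx phi k) (map_mx phi C) (map_mx phi b1) (map_mx phi c) (map_mx phi x).
Proof. by rewrite /cubic_lhs map_bracket !map_cross. Qed.

Lemma map_aux_lhs a A a1 b B k C b1 c x :
  phi (aux_lhs a A a1 b B k C b1 c x)
  = aux_lhs (map_mx phi a) (map_mx phi A) (map_mx phi a1) (map_mx phi b) (map_mx phi B)
      (map_mx phi k) (map_mx phi C) (map_mx phi b1) (map_mx phi c) (map_mx phi x).
Proof. by rewrite /aux_lhs map_bracket !map_cross. Qed.

Lemma map_tau_aux_scale a A a1 c y :
  phi (tau_aux_scale a A a1 c y)
  = tau_aux_scale (map_mx phi a) (map_mx phi A) (map_mx phi a1) (map_mx phi c)
      (map_mx phi y).
Proof. by rewrite /tau_aux_scale !rmorphM rmorphN map_bracket !map_dot !map_cross. Qed.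

Lemma map_pencil p q M N t :
  phi ((p *: M - q *: N) *d t)
  = phi p * (map_mx phi M *d map_mx phi t) - phi q * (map_mx phi N *d map_mx phi t).
Proof. by rewrite dotBl !dotZl rmorphB !rmorphM !map_dot. Qed.

End MorphismForms.

Section Lifting.
Variable F : fieldType.
Implicit Types (u v w : 'rV[F]_3).

Lemma liftE u j : lift u 0 j = (u 0 j)%:MP. Proof. exact: mxE. Qed.

Lemma generic_pointE j : generic_point F 0 j = 'X_j. Proof. exact: mxE. Qed.

Lemma lift_cross u v : lift (u *v v) = lift u *v lift v.
Proof. exact: map_cross. Qed.

Lemma liftZ s u : lift (s *: u) = s%:MP *: lift u.
Proof. by apply/rowP => j; rewrite !mxE mpolyCM. Qed.

Lemma liftD u v : lift (u + v) = lift u + lift v.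
Proof. by apply/rowP => j; rewrite !mxE mpolyCD. Qed.

Lemma lift_frame p q r x y z :
  lift (frame p q r x y z : 'rV[F]_3)
  = frame (lift p) (lift q) (lift r) x%:MP y%:MP z%:MP.
Proof. by rewrite /frame !liftD !liftZ. Qed.

Lemma lift_dual_frame p q r x y z :
  lift (dual_frame p q r x y z : 'rV[F]_3)
  = dual_frame (lift p) (lift q) (lift r) x%:MP y%:MP z%:MP.
Proof. by rewrite /dual_frame !liftD !liftZ !lift_cross. Qed.

Lemma lift_bracket u v w : (bracket u v w)%:MP = bracket (lift u) (lift v) (lift w).
Proof. exact: map_bracket. Qed.

Lemma eval_lift (x : 'rV[F]_3) v : map_mx (meval (fun j => x 0 j)) (lift v) = v.
Proof. by apply/rowP => j; rewrite !mxE mevalC. Qed.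

Lemma eval_generic_point (x : 'rV[F]_3) :
  map_mx (meval (fun j => x 0 j)) (generic_point F) = x.
Proof. by apply/rowP => j; rewrite !mxE mevalXU. Qed.

Lemma eval_cubic_form a A a1 b B k C b1 c (x : 'rV[F]_3) :
  (cubic_form a A a1 b B k C b1 c).@[fun j => x 0 j] = cubic_lhs a A a1 b B k C b1 c x.
Proof.
rewrite [LHS](map_cubic_lhs (meval (fun j => x 0 j))).
by rewrite (eval_generic_point x) (eval_lift x a) (eval_lift x A) (eval_lift x a1)
  (eval_lift x b) (eval_lift x B) (eval_lift x k) (eval_lift x C) (eval_lift x b1)
  (eval_lift x c).
Qed.

Lemma eval_aux_form a A a1 b B k C b1 c (x : 'rV[F]_3) :
  (aux_form a A a1 b B k C b1 c).@[fun j => x 0 j] = aux_lhs a A a1 b B k C b1 c x.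
Proof.
rewrite [LHS](map_aux_lhs (meval (fun j => x 0 j))).
by rewrite (eval_generic_point x) (eval_lift x a) (eval_lift x A) (eval_lift x a1)
  (eval_lift x b) (eval_lift x B) (eval_lift x k) (eval_lift x C) (eval_lift x b1)
  (eval_lift x c).
Qed.

Lemma mul_lift_outer (u v : 'rV[F]_3) (x : 'rV[{mpoly F[3]}]_3) :
  x *m map_mx (@mpolyC 3 F) (u^T *m v) = (x *d lift u) *: lift v.
Proof. by rewrite map_mxM /= mulmxA -map_trmx [x *m _]mx11_scalar mul_scalar_mx. Qed.
Lemma eval_bracket_generic (x : 'rV[F]_3) u v :
  (bracket (generic_point F) (lift u) (lift v)).@[fun j => x 0 j] = bracket x u v.
Proof.
by rewrite [LHS](map_bracket (meval (fun j => x 0 j))) (eval_generic_point x)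
  (eval_lift x u) (eval_lift x v).
Qed.

(** Each product of a linear form in [x] and one in [w] is given by a rank-one matrix. With [w] the
    generic value of [tau], this assembles the linear map [W] of a cubic. *)
Lemma mul_lift_outer3 (u0 u1 u2 v0 v1 v2 : 'rV[F]_3) (x w : 'rV[{mpoly F[3]}]_3) :
  (x *m map_mx (@mpolyC 3 F) (u0^T *m v0 + u1^T *m v1 + u2^T *m v2)) *d w
  = (x *d lift u0) * (w *d lift v0) + (x *d lift u1) * (w *d lift v1)
    + (x *d lift u2) * (w *d lift v2).
Proof.
rewrite !map_mxD !mulmxDr !mul_lift_outer.
move: (lift v0) (lift v1) (lift v2) => w0 w1 w2.
by rewrite !dotDl !dotZl (dotC w0) (dotC w1) (dotC w2).
Qed.
End Lifting.

(* Both lines added to [x *m W] pass through [tau x], so [corrected x] and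
   [x *m W] define the same cubic. *)
Section LinearCorrection.
Variables (R : comNzRingType) (W : 'M[R]_3) (a A a1 c : 'rV[R]_3) (s t : R).

Definition corrected x := x *m W - s *: (x *v a *v A *v a1) - t *: (x *v c).

Lemma corrected_frame p q r x y z :
  corrected (frame p q r x y z) = frame (corrected p) (corrected q) (corrected r) x y z.
Proof.
rewrite /corrected !frame_crossl.
have -> : frame p q r x y z *m W = frame (p *m W) (q *m W) (r *m W) x y z.
  by rewrite /frame !mulmxDl -!scalemxAl.
move: (_ *v a1) (q *v a *v A *v a1) (r *v a *v A *v a1) (_ *m W) (q *m W) (r *m W).
by move=> p1 q1 r1 p2 q2 r2; rewrite /frame; coords.
Qed.

Lemma corrected_tau x : corrected x *d tau a A a1 c x = (x *m W) *d tau a A a1 c x.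
Proof.
by rewrite /corrected /tau !dotBl !dotZl dot_cross_l dot_cross_r; ring.
Qed.

(** By Cramer's rule [bracket b e f *: x] is a combination of [b], [e], [f], and the linear map
    [corrected] kills the part along [b]. *)
Lemma corrected_pencil b e f x : corrected b = 0 ->
  bracket b e f *: corrected x
  = bracket x b e *: corrected f - bracket x b f *: corrected e.
Proof.
move=> b0; have := corrected_frame b e f (bracket x e f) (bracket b x f) (bracket b e x).
rewrite -cramer b0.
have -> : corrected (bracket b e f *: x) = bracket b e f *: corrected x.
  rewrite /corrected -scalemxAl !crossZl.
  by move: (_ *m W) (_ *v a1) (x *v c) => p q r; coords.
by move=> ->; move: (corrected e) (corrected f) => p q; rewrite /frame; coords.
Qed.
End LinearCorrection.

Lemma pencil_scale (R : comNzRingType) (u v t : 'rV[R]_3) p q l :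
  (p *: (l *: u) - q *: (l *: v)) *d t = - l * - ((p *: u - q *: v) *d t).
Proof. by rewrite !dotBl !dotZl; ring. Qed.

Lemma equation_of_proportional (F : fieldType) (G E : {mpoly F[3]}) (s l : F) :
  s != 0 -> G != 0 -> s%:MP * G = - l%:MP * E -> equation_of G E.
Proof.
move=> s0 G0 GE.
have l0 : l != 0.
  apply: contraNneq G0 => l0; move/eqP: GE.
  rewrite l0 mpolyC0 oppr0 mul0r mulf_eq0 => /orP[|//].
  by rewrite mpolyC_eq0 (negPf s0).
exists (- l^-1 * s); first by rewrite mulf_neq0 ?oppr_eq0 ?invr_eq0.
by rewrite -mul_mpolyC mpolyCM -mulrA GE mulrA mpolyCN mulrNN -mpolyCM mulVf // mpolyC1 mul1r.
Qed.

(** * The third intersection point on the line ef *)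

Section ThirdPoint.
Variable F : fieldType.
Implicit Types e f y : 'rV[F]_3.

(** At the parameters [[s : t]] of [y] the last linear factor of the restricted form vanishes. *)
Lemma third_point_on_curve (G : {mpoly F[3]}) e f y : third_point G e f y -> on_curve G y.
Proof.
move=> [_ [s [t [l [-> _ E]]]]].
have := congr1 (meval (fun j : 'I_2 => if j == 0 then s else t)) E.
rewrite /restrict_to_line comp_mpoly_meval mevalZ !mevalM mevalB !mevalZ !mevalXU /=.
rewrite [t * s]mulrC subrr !mulr0 /on_curve => <-; apply: meval_eq => j.
by rewrite tnth_mktuple mevalD !mevalZ !mevalXU !mxE /= [s * _]mulrC [t * _]mulrC.
Qed.

(** For [G = 0] the factor [t *: 'X_0 - s *: 'X_1] would be zero, so [s = t = 0], against
    [y != 0]. *)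
Lemma third_point_neq0 (G : {mpoly F[3]}) e f y : third_point G e f y -> G != 0.
Proof.
move=> [y0 [s [t [l [yE l0 E]]]]]; apply: contraNneq y0 => G0.
have : l *: ('X_0 * 'X_1 * (t *: 'X_0 - s *: 'X_1)) = 0 :> {mpoly F[2]}.
  by rewrite -E G0 /restrict_to_line raddf0.
have X0 i : 'X_i != 0 :> {mpoly F[2]}.
  apply/eqP => /(congr1 (meval (fun=> 1))); rewrite mevalXU meval0 => /eqP.
  by rewrite oner_eq0.
move/eqP; rewrite scaler_eq0 (negPf l0) !mulf_eq0 !(negPf (X0 _)) /= => /eqP E0.
have := congr1 (meval (fun j : 'I_2 => (j == 0)%:R)) E0.
have := congr1 (meval (fun j : 'I_2 => (j != 0)%:R)) E0.
rewrite !mevalB !mevalZ !mevalXU meval0 /= !mulr0 !mulr1 sub0r subr0 => /eqP.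
by rewrite oppr_eq0 yE => /eqP -> ->; rewrite meval0 !scale0r addr0.
Qed.
End ThirdPoint.

(** * Conics and cubics through the given points *)

Section NinePoints.
Variables (F : fieldType) (a c d e f : 'rV[F]_3).
Hypotheses (acd : bracket a c d != 0) (ecd : bracket e c d != 0)
  (aed : bracket a e d != 0) (ace : bracket a c e != 0)
  (fcd : bracket f c d != 0) (afd : bracket a f d != 0) (acf : bracket a c f != 0)
  (cfe : bracket c f e != 0) (aef : bracket a e f != 0) (def : bracket d e f != 0).

Local Notation A := (d *v e).
Local Notation B := (f *v e).
Local Notation a1 := ((a *v f) *v (d *v c)).
Local Notation gen := (generic_point F).
Local Notation X := (bracket gen (lift c) (lift d)).
Local Notation Y := (bracket (lift a) gen (lift d)).
Local Notation Z := (bracket (lift a) (lift c) gen).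
Local Notation T := (tau (lift a) (lift A) (lift a1) (lift c) gen).

Lemma frame_coords5 : exists e0 e1 e2 f0 f1 f2,
  [/\ e = frame a c d e0 e1 e2, f = frame a c d f0 f1 f2,
   [/\ e0 != 0, e1 != 0 & e2 != 0] & [/\ f0 != 0, f1 != 0 & f2 != 0]].
Proof.
have [e0 [e1 [e2 eE]]] := frame_coord e acd.
have [f0 [f1 [f2 fE]]] := frame_coord f acd.
have h (x y z : F) (v : 'rV_3) : v = frame a c d x y z ->
  [/\ bracket v c d = x * bracket a c d, bracket a v d = y * bracket a c d
    & bracket a c v = z * bracket a c d].
  by move->; rewrite /frame; split; coords.
exists e0, e1, e2, f0, f1, f2; split=> //.
  have [h0 h1 h2] := h _ _ _ _ eE; move: ecd aed ace; rewrite h0 h1 h2 !mulf_eq0 !negb_or.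
  by do 3!case/andP => ? _.
have [h0 h1 h2] := h _ _ _ _ fE; move: fcd afd acf; rewrite h0 h1 h2 !mulf_eq0 !negb_or.
by do 3!case/andP => ? _.
Qed.

(** The frame coordinates of [tau] are combinations of [Y * Z], [X * Z] and [X * Y]; this system is
    invertible since the coordinates of [e] and [f] are nonzero. *)
Lemma tau_products : exists v0 v1 v2 : 'rV[F]_3,
  [/\ Y * Z = T *d lift v0, X * Z = T *d lift v1 & X * Y = T *d lift v2].
Proof.
have [e0 [e1 [e2 [f0 [f1 [f2 [eE fE [e00 e10 e20] [f00 f10 f20]]]]]]]] := frame_coords5.
pose D := bracket a c d; have acd' : D != 0 := acd.
have D0 : D%:MP_[3] != 0 by rewrite mpolyC_eq0.
have TE l m n : T *d lift (dual_frame a c d l m n)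
    = D%:MP ^+ 2 * (e0%:MP * f2%:MP * (X * Y) * l%:MP
     + (e0%:MP * f1%:MP * (Y * Z) + e1%:MP * f2%:MP * (X * Y)
        - e1%:MP * f1%:MP * (X * Z)) * m%:MP
     + e0%:MP * f2%:MP * (Y * Z) * n%:MP).
  apply: (mulfI (expf_neq0 2 D0)); rewrite /D lift_bracket.
  rewrite lift_dual_frame !lift_cross eE fE !lift_frame.
  exact: tau_dot.
have solve s p v : s != 0 -> T *d lift v = s%:MP * p -> p = T *d lift (s^-1 *: v).
  by move=> s0 Tv; rewrite liftZ dotZr Tv mulrA -mpolyCM mulVf // mpolyC1 mul1r.
clearbody D; move: X Y Z TE => x y z TE.
exists ((D ^+ 2 * e0 * f2)^-1 *: dual_frame a c d 0 0 1).
(* These coefficients cancel [X * Y] and [Y * Z] from the middle coordinate of [tau], leaving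
   [X * Z]. *)
exists ((D ^+ 2 * (e0 * e1 * f1 * f2))^-1
        *: dual_frame a c d (e1 * f2) (- (e0 * f2)) (e0 * f1)).
exists ((D ^+ 2 * e0 * f2)^-1 *: dual_frame a c d 1 0 0).
split; apply: solve; rewrite ?mulf_neq0 ?expf_neq0 // TE;
  rewrite !expr2 ?(mpolyCN, mpolyCM, mpolyC0, mpolyC1); ring.
Qed.

Lemma frame_forms_span j : exists s t u : F, 'X_j = s *: X + t *: Y + u *: Z.
Proof.
have := cramer_coord (lift a) (lift c) (lift d) gen j.
rewrite (liftE a) (liftE c) (liftE d) generic_pointE -(lift_bracket a c d) => h.
have D0 : (bracket a c d)%:MP_[3] != 0 by rewrite mpolyC_eq0.
exists ((bracket a c d)^-1 * a 0 j), ((bracket a c d)^-1 * c 0 j),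
  ((bracket a c d)^-1 * d 0 j).
apply: (mulfI D0); rewrite h -!mul_mpolyC !mpolyCM.
have E : (bracket a c d)%:MP_[3] * ((bracket a c d)^-1)%:MP = 1 by rewrite -mpolyCM divff.
move: X Y Z E => x y z; move: (bracket a c d)%:MP (_^-1)%:MP => D V E.
rewrite -[LHS]mul1r -E; ring.
Qed.

Lemma eval_frame_forms (x : 'rV[F]_3) :
  [/\ X.@[fun j => x 0 j] = bracket x c d, Y.@[fun j => x 0 j] = bracket a x d
    & Z.@[fun j => x 0 j] = bracket a c x].
Proof.
by split; rewrite [LHS](map_bracket (meval (fun j => x 0 j))) (eval_generic_point x)
  ?(eval_lift x a) ?(eval_lift x c) ?(eval_lift x d).
Qed.

Lemma frame_forms_at : [/\
  [/\ X.@[fun j => a 0 j] != 0, Y.@[fun j => a 0 j] = 0 & Z.@[fun j => a 0 j] = 0],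
  [/\ X.@[fun j => c 0 j] = 0, Y.@[fun j => c 0 j] != 0 & Z.@[fun j => c 0 j] = 0] &
  [/\ X.@[fun j => d 0 j] = 0, Y.@[fun j => d 0 j] = 0 & Z.@[fun j => d 0 j] != 0]].
Proof.
have [aX aY aZ] := eval_frame_forms a; have [cX cY cZ] := eval_frame_forms c.
have [dX dY dZ] := eval_frame_forms d.
split; split.
- by rewrite aX.
- by rewrite aY; coords.
- by rewrite aZ; coords.
- by rewrite cX; coords.
- by rewrite cY.
- by rewrite cZ; coords.
- by rewrite dX; coords.
- by rewrite dY; coords.
- by rewrite dZ.
Qed.

Lemma conic_tau Q : Q \is 2.-homog -> on_curve Q a -> on_curve Q c -> on_curve Q d ->
  exists L : 'rV[F]_3, Q = lift L *d T.
Proof.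
have [at0 at1 at2] := frame_forms_at.
move=> hQ Qa Qc Qd.
have [s [t [u QE]]] := conic_through_frame frame_forms_span at0 at1 at2 hQ Qa Qc Qd.
have [v0 [v1 [v2 [h0 h1 h2]]]] := tau_products.
move: QE h0 h1 h2; move: X Y Z T => x y z t0 -> -> -> ->.
by exists (frame v0 v1 v2 s t u); rewrite lift_frame frame_dotl.
Qed.

Lemma spanned1_dot l : spanned X Y Z 1 l -> exists m : 'rV[F]_3, l = gen *d lift m.
Proof.
move=> /= [_ [_ [_ [[s ->] [t ->] [u ->] ->]]]].
by exists (dual_frame a c d s t u); rewrite lift_dual_frame dot_dual_frame.
Qed.

Lemma cubic_tau G : G \is 3.-homog -> on_curve G a -> on_curve G c -> on_curve G d ->
  exists W : 'M[F]_3, G = (gen *m map_mx (@mpolyC 3 F) W) *d T.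
Proof.
have [at0 at1 at2] := frame_forms_at.
move=> hG Ga Gc Gd.
have [l0 [l1 [l2 [/spanned1_dot [m0 ->] /spanned1_dot [m1 ->] /spanned1_dot [m2 ->] ->]]]] :=
  cubic_through_frame frame_forms_span at0 at1 at2 hG Ga Gc Gd.
have [v0 [v1 [v2 [h0 h1 h2]]]] := tau_products.
move: h0 h1 h2; move: X Y Z T => x y z t0 -> -> ->.
exists (m0^T *m v0 + m1^T *m v1 + m2^T *m v2).
exact/esym/mul_lift_outer3.
Qed.

(** Geometrically, eaAa_1 passes through [e] because [e] lies on [A], and faAa_1 is the line af
    because [a1] lies on it. The frame coordinates show that the scalars are nonzero. *)
Lemma tau_fixed : exists s t,
  [/\ s != 0, t != 0, tau a A a1 c e = s *: e & tau a A a1 c f = t *: f].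
Proof.
have [e0 [e1 [e2 [f0 [f1 [f2 [eE fE [e00 e10 e20] [f00 f10 f20]]]]]]]] := frame_coords5.
have tE x y z := tau_frame a c d e0 e1 e2 f0 f1 f2 x y z.
move: tE; cbv zeta; rewrite -eE -fE => tE.
exists (bracket a c d ^+ 3 * (e0 * e1 * f2)), (bracket a c d ^+ 3 * (e0 * f1 * f2)).
rewrite ?mulf_neq0 ?expf_neq0 //; split=> //.
  have := tE e0 e1 e2; rewrite -eE => ->.
  by rewrite [in RHS]eE !frameZ; congr frame; ring.
have := tE f0 f1 f2; rewrite -fE => ->.
by rewrite [in RHS]fE !frameZ; congr frame; ring.
Qed.

(** Up to nonzero factors the last frame coordinate of [tau] at [b] is
    [bracket a b d * bracket a c b]. *)
Lemma tau_neq0 b : bracket a b d != 0 -> bracket a c b != 0 -> tau a A a1 c b != 0.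
Proof.
move=> abd acb.
have [e0 [e1 [e2 [f0 [f1 [f2 [eE fE [e00 e10 e20] [f00 f10 f20]]]]]]]] := frame_coords5.
have D2 : bracket a c d ^+ 2 != 0 by rewrite expf_neq0.
apply: contraNneq (_ : tau a A a1 c b *d dual_frame a c d 0 0 1 != 0) => [->|].
  by rewrite dot0l.
have := tau_dot a c d b e0 e1 e2 f0 f1 f2 0 0 1; cbv zeta; rewrite -eE -fE.
move=> /(mulfI D2) ->; rewrite !(mulr0, mulr1, add0r).
by rewrite !mulf_neq0.
Qed.

Lemma eval_tau (x : 'rV[F]_3) : map_mx (meval (fun j => x 0 j)) T = tau a A a1 c x.
Proof.
rewrite (map_tau (meval (fun j => x 0 j))).
by rewrite (eval_generic_point x) (eval_lift x a) (eval_lift x A) (eval_lift x a1)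
  (eval_lift x c).
Qed.

Lemma conic_equation Q : Q != 0 -> Q \is 2.-homog ->
  on_curve Q a -> on_curve Q c -> on_curve Q d -> on_curve Q e -> on_curve Q f ->
  exists2 l, l != 0
    & forall x : 'rV[F]_3, Q.@[fun j => x 0 j] = l * (B *d tau a A a1 c x).
Proof.
move=> Q0 hQ Qa Qc Qd Qe Qf.
have [L QE] := conic_tau hQ Qa Qc Qd.
have QxE (x : 'rV[F]_3) : Q.@[fun j => x 0 j] = L *d tau a A a1 c x.
  by rewrite -eval_tau -{1}(eval_lift x L) -(map_dot (meval (fun j => x 0 j))) QE.
have [s [t [s0 t0 te tf]]] := tau_fixed.
have Le : L *d e = 0.
  by move: Qe; rewrite /on_curve QxE te dotZr => /eqP; rewrite mulf_eq0 (negPf s0) => /eqP.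
have Lf : L *d f = 0.
  by move: Qf; rewrite /on_curve QxE tf dotZr => /eqP; rewrite mulf_eq0 (negPf t0) => /eqP.
have [l LE] := orthogonal_join cfe Le Lf.
exists l; last by move=> x; rewrite QxE LE dotZl.
apply: contraNneq Q0 => l0; rewrite QE LE l0 scale0r.
have -> : lift (0 : 'rV[F]_3) = 0 by apply/rowP => j; rewrite !mxE mpolyC0.
by rewrite dot0l.
Qed.

Lemma cubic_pencil G b : G \is 3.-homog ->
  on_curve G a -> on_curve G c -> on_curve G d -> on_curve G b ->
  bracket a b d != 0 -> bracket a c b != 0 ->
  exists M N : 'rV[F]_3, (bracket b e f)%:MP * G =
   (bracket gen (lift b) (lift e) *: lift M
    - bracket gen (lift b) (lift f) *: lift N) *d T.
Proof.
move=> hG Ga Gc Gd Gb abd acb.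
have [W GE] := cubic_tau hG Ga Gc Gd.
have Wb : (b *m W) *d tau a A a1 c b = 0.
  rewrite -Gb GE (map_dot (meval (fun j => b 0 j))) eval_tau; congr (_ *d _).
  rewrite map_mxM (eval_generic_point b); congr (_ *m _).
  by apply/matrixP => i j; rewrite !mxE; exact/esym/mevalC.
(* Since [tau] is nonzero at [b], the lines baAa_1 and bc are independent and span all lines through
   that point, so subtracting a combination of them makes the map vanish at [b]. *)
have [s [t bW]] := dot_cross_eq0_span (tau_neq0 abd acb) Wb.
pose W' := corrected W a A a1 c s t.
have liftW x : lift (W' x)
  = corrected (map_mx (@mpolyC 3 F) W) (lift a) (lift A) (lift a1) (lift c)
      s%:MP t%:MP (lift x).
  have liftB u v : lift (u - v) = lift u - lift v :> 'rV[{mpoly F[3]}]_3.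
    by apply/rowP => j; rewrite !mxE mpolyCB.
  rewrite /W' /corrected !liftB (liftZ s) (liftZ t) !(lift_cross _ c)
    (lift_cross _ a1) (lift_cross _ A) (lift_cross _ a).
  by rewrite /lift map_mxM.
exists (W' f), (W' e).
rewrite !liftW -corrected_pencil; last first.
  rewrite -liftW /W' /corrected bW.
  by apply/rowP => j; rewrite !mxE; ring.
by rewrite dotZl corrected_tau -GE lift_bracket.
Qed.

Lemma cubic_form_tau b k C b1 : cubic_form a A a1 b B k C b1 c =
  - ((bracket gen (lift b) (lift e) *: lift (f *v k *v C *v b1)
      - bracket gen (lift b) (lift f) *: lift (e *v k *v C *v b1)) *d T).
Proof.
rewrite !(lift_cross _ b1) !(lift_cross _ C) !(lift_cross _ k) -cubic_lhs_tau.
by rewrite -(lift_cross f e).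
Qed.

Lemma cubic_form_eq0 b k C b1 :
  f *v k *v C *v b1 = 0 -> e *v k *v C *v b1 = 0 -> cubic_form a A a1 b B k C b1 c = 0.
Proof.
rewrite cubic_form_tau => -> ->.
have -> : lift (0 : 'rV[F]_3) = 0 by apply/rowP => j; rewrite !mxE mpolyC0.
by move: T (bracket _ _ _) (bracket _ _ _) => t p q; rewrite !scaler0 subr0 dot0l oppr0.
Qed.

Lemma scaled_pencil b k C b1 l :
  (bracket gen (lift b) (lift e) *: lift (l *: (f *v k *v C *v b1))
   - bracket gen (lift b) (lift f) *: lift (l *: (e *v k *v C *v b1))) *d T
  = - l%:MP * cubic_form a A a1 b B k C b1 c.
Proof.
by rewrite cubic_form_tau !(liftZ l); exact: pencil_scale.
Qed.

(** A nonzero multiple of [G] is in pencil form with lines [M], [N]. Vanishing at e, f, g, h, i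
    gives the five conditions of [pencil_unique], and [cubic != 0] makes the constructed solution
    nonzero. *)
Lemma cubic_equation G b g h i
  (g1 := tau a A a1 c g) (h1 := tau a A a1 c h) (i1 := tau a A a1 c i)
  (g2 := g *v b *v B) (h2 := h *v b *v B) (i2 := i *v b *v B) (C := e *v i1)
  (u := (h1 *v g1 *v C *v g2) *v (f *v h1)) (v := (g1 *v h1 *v C *v h2) *v (f *v g1))
  (K := u *v v) (k := K *v (i1 *v i2)) (b1 := (k *v g2 *v C *v g1) *v (k *v f))
  (cubic := cubic_form a A a1 b B k C b1 c) :
  G != 0 -> G \is 3.-homog ->
  {in [:: a; c; d; e; f; b; g; h; i], forall x, on_curve G x} ->
  bracket a b d != 0 -> bracket a c b != 0 -> bracket b e f != 0 ->
  cubic != 0 -> equation_of G cubic.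
Proof.
move=> G0 hG onG abd acb bef cubic0.
have on x : x \in [:: a; c; d; e; f; b; g; h; i] -> G.@[fun j => x 0 j] = 0.
  by move=> xin; apply: onG.
have [M [N MN]] : exists M N : 'rV[F]_3, (bracket b e f)%:MP * G =
   (bracket gen (lift b) (lift e) *: lift M
    - bracket gen (lift b) (lift f) *: lift N) *d T.
  by apply: cubic_pencil => //; apply: onG; rewrite !inE eqxx ?orbT.
have MNx (x : 'rV[F]_3) : x \in [:: a; c; d; e; f; b; g; h; i] ->
    bracket x b e * (M *d tau a A a1 c x) = bracket x b f * (N *d tau a A a1 c x).
  move=> /on Gx; have := congr1 (meval (fun j => x 0 j)) MN.
  rewrite mevalM Gx mulr0 [X in _ = X](map_pencil (meval (fun j => x 0 j))).
  rewrite (eval_tau x) (eval_lift x M) (eval_lift x N).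
  move=> E; apply/subr0_eq/esym; rewrite [LHS]E.
  by congr (_ * _ - _ * _); exact: eval_bracket_generic.
have [s [t [s0 t0 te tf]]] := tau_fixed.
(* At [f] the bracket in front of [N] vanishes, which isolates [M]; at [e] the roles are
   exchanged. *)
have Mf : M *d f = 0.
  have := MNx f; rewrite tf !dotZr !inE eqxx !orbT => /(_ isT).
  have -> : bracket f b f = 0 by coords.
  have -> : bracket f b e = bracket b e f by coords.
  by rewrite mul0r => /eqP; rewrite !mulf_eq0 (negPf bef) (negPf t0) => /eqP.
have Ne : N *d e = 0.
  have := MNx e; rewrite te !dotZr !inE eqxx !orbT => /(_ isT).
  have -> : bracket e b e = 0 by coords.
  have -> : bracket e b f = - bracket b e f by coords.
  by rewrite mul0r => /esym/eqP; rewrite !mulf_eq0 oppr_eq0 (negPf bef) (negPf s0) => /eqP.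
have nz : f *v k *v C *v b1 != 0 \/ e *v k *v C *v b1 != 0.
  apply/orP; rewrite -negb_and; apply: contra cubic0 => /andP[/eqP z1 /eqP z2].
  by apply/eqP; apply: cubic_form_eq0.
have [l [Ml Nl]] : exists l, M = l *: (f *v k *v C *v b1) /\ N = l *: (e *v k *v C *v b1).
  apply: (pencil_unique (join_meet e f b g) (join_meet e f b h)
    (join_meet e f b i) Mf Ne _ _ _ nz); by apply: MNx; rewrite !inE eqxx !orbT.
apply: (equation_of_proportional (l := l) bef G0).
by rewrite MN Ml Nl; apply: scaled_pencil.
Qed.

(** At [e] every factor is, up to sign, a product of nonzero brackets. So the scale is not the zero
    polynomial. *)
Lemma tau_aux_scale_neq0 : tau_aux_scale a A a1 c e != 0.
Proof.
have Aa1 : A *d a1 = - bracket e c d * bracket a f d by coords.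
have ea1c : bracket e a1 c = bracket a c f * bracket e c d by coords.
have aA : a *d A = - bracket a e d by coords.
have eca : (e *v c) *d a = - bracket a c e by coords.
have lc : (e *v a1 *v A *v a) *d c = - (A *d a1) * bracket a c e.
  rewrite (double_cross e a1) dot_cross_r scale0r sub0r dotC; move: a1 (d *v e) => p q.
  by coords.
by rewrite /tau_aux_scale lc Aa1 ea1c aA eca !(mulf_eq0, oppr_eq0) !negb_or
  ecd afd ace aed acf.
Qed.

(** Substituting the generic auxiliary point in the cubic form gives the scale times the auxiliary
    form. Polynomials over a field form a domain, and the scale is nonzero at [e]. *)
Lemma aux_form_eq0 b k C b1 :
  cubic_form a A a1 b B k C b1 c = 0 -> aux_form a A a1 b B k C b1 c = 0.
Proof.
pose z := aux_point (lift a) (lift A) (lift a1) (lift c) gen.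
pose phi := comp_mpoly [tuple z 0 j | j < 3].
have phi_lift (v : 'rV[F]_3) : map_mx phi (lift v) = lift v.
  by apply/rowP => j; rewrite !mxE /phi comp_mpolyC.
have phi_gen : map_mx phi gen = z.
  by apply/rowP => j; rewrite mxE generic_pointE /phi comp_mpolyXU -tnth_nth tnth_mktuple.
have phi0 : phi 0 = 0 by rewrite /phi raddf0.
move/(congr1 phi); rewrite phi0 [LHS](map_cubic_lhs phi) phi_gen (phi_lift a)
  (phi_lift A) (phi_lift a1) (phi_lift b) (phi_lift B) (phi_lift k) (phi_lift C)
  (phi_lift b1) (phi_lift c).
rewrite cubic_aux_point => /eqP; rewrite mulf_eq0 => /orP[/eqP s0|/eqP //].
have := tau_aux_scale_neq0; have := congr1 (meval (fun j => e 0 j)) s0.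
rewrite meval0 => E; apply: contraNeq => _; apply/eqP; rewrite -[RHS]E.
rewrite [RHS](map_tau_aux_scale (meval (fun j => e 0 j))).
by rewrite (eval_generic_point e) (eval_lift e a) (eval_lift e A) (eval_lift e a1)
  (eval_lift e c).
Qed.

(** Up to nonzero factors the frame coordinates of the auxiliary point are the pairwise products of
    three linear forms [y0], [y2], [w] in [s], [t]. If all products vanish, so do two of the forms;
    any two are independent because [cfe], [aef] and [def] are nonzero. *)
Lemma aux_point_neq0 s t : s *: e + t *: f != 0 ->
  aux_point a A a1 c (s *: e + t *: f) != 0.
Proof.
have [e0 [e1 [e2 [f0 [f1 [f2 [eE fE [e00 e10 e20] [f00 f10 f20]]]]]]]] := frame_coords5.
have yE : s *: e + t *: f
    = frame a c d (s * e0 + t * f0) (s * e1 + t * f1) (s * e2 + t * f2).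
  by rewrite eE fE /frame; coords.
have D1 : bracket c f e = bracket a c d * (f2 * e0 - f0 * e2).
  by rewrite eE fE /frame; coords.
have D2 : bracket a e f = bracket a c d * (e1 * f2 - f1 * e2).
  by rewrite eE fE /frame; coords.
have D3 : bracket d e f = bracket a c d * (e0 * f1 - f0 * e1).
  by rewrite eE fE /frame; coords.
move: cfe aef def; rewrite D1 D2 D3 !mulf_eq0 !negb_or => /andP[_ d1] /andP[_ d2] /andP[_ d3].
apply: contraNneq => aux0.
suff [-> ->] : s = 0 /\ t = 0 by rewrite !scale0r addr0.
move: aux0; rewrite yE; have := aux_point_frame a c d e0 e1 e2 f0 f1 f2
  (s * e0 + t * f0) (s * e1 + t * f1) (s * e2 + t * f2).
cbv zeta; rewrite -eE -fE => -> /eqP.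
rewrite scaler_eq0 oppr_eq0 expf_eq0 /= (negPf acd) /= => /eqP/(frame_eq0 acd).
set y0 := _ + t * f0; set y2 := s * e2 + _; set w := (_ - _) * e0 - _.
move=> -[/eqP z0 /eqP z1 /eqP z2].
have wE : w = - (s * e0 * e2 * f1 + t * f0 * f2 * e1) by rewrite /w /y0 /y2; ring.
have cancel (x z : F) : z != 0 -> x * z = 0 -> x = 0.
  by move=> z0' /eqP; rewrite mulf_eq0 (negPf z0') orbF => /eqP.
have y02 : y0 = 0 -> y2 = 0 -> s = 0 /\ t = 0.
  move=> y00 y20; split; apply: (cancel _ _ d1).
    by transitivity (f2 * y0 - f0 * y2); [rewrite /y0 /y2; ring | rewrite y00 y20; ring].
  by transitivity (e0 * y2 - e2 * y0); [rewrite /y0 /y2; ring | rewrite y00 y20; ring].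
have y0w : y0 = 0 -> w = 0 -> s = 0 /\ t = 0.
  move=> y00 w0; have t0 : t = 0.
    apply: (cancel _ _ f00); apply: (cancel _ _ d2).
    by transitivity (- w - e2 * f1 * y0); [rewrite wE /y0; ring | rewrite w0 y00; ring].
  by split=> //; apply: (cancel _ _ e00); rewrite -y00 /y0 t0; ring.
have y2w : y2 = 0 -> w = 0 -> s = 0 /\ t = 0.
  move=> y20 w0; have t0 : t = 0.
    apply: (cancel _ _ f20); apply: (cancel _ _ d3).
    by transitivity (w + e0 * f1 * y2); [rewrite wE /y2; ring | rewrite w0 y20; ring].
  by split=> //; apply: (cancel _ _ e20); rewrite -y20 /y2 t0; ring.
move: z0 z1 z2; rewrite !oppr_eq0 !mulf_eq0 (negPf e10) (negPf f10) !orbF.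
case/orP => /eqP h0 /orP[] /eqP h1 /orP[] /eqP h2; by [apply: y02 | apply: y0w | apply: y2w].
Qed.
End NinePoints.

Lemma general_bracket (F : fieldType) (s : seq 'rV[F]_3) i j k :
  general_position s -> (i < j < k)%N -> (k < size s)%N ->
  bracket s`_i s`_j s`_k != 0.
Proof. by move=> gen ijk ks; apply: bracket_neq0; apply: gen. Qed.

Lemma bracket_rot (R : comNzRingType) (u v w : 'rV[R]_3) :
  bracket u v w = bracket v w u.
Proof. by coords. Qed.

Lemma bracket_swap (R : comNzRingType) (u v w : 'rV[R]_3) :
  bracket u v w = - bracket u w v.
Proof. by coords. Qed.

Theorem theorem4p8 (F : fieldType) (a b c d e f g h i : 'rV[F]_3)
    (Q G : {mpoly F[3]})
    (general : general_position [:: a; b; c; d; e; f; g; h; i])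
    (conicQ : curve 2 Q) (cubicG : curve 3 G)
    (onQ : {in [:: a; c; d; e; f], forall x, on_curve Q x})
    (onG : {in [:: a; c; d; e; f; b; g; h; i], forall x, on_curve G x}) :
  let A := d *v e in
  let B := f *v e in
  let a1 := (a *v f) *v (d *v c) in
  let g1 := (g *v a *v A *v a1) *v (g *v c) in
  let h1 := (h *v a *v A *v a1) *v (h *v c) in
  let i1 := (i *v a *v A *v a1) *v (i *v c) in
  let g2 := g *v b *v B in
  let h2 := h *v b *v B in
  let i2 := i *v b *v B in
  let C := e *v i1 in
  let u := (h1 *v g1 *v C *v g2) *v (f *v h1) in
  let v := (g1 *v h1 *v C *v h2) *v (f *v g1) in
  let K := u *v v in
  let k := K *v (i1 *v i2) in
  let b1 := (k *v g2 *v C *v g1) *v (k *v f) in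
  let cubic := cubic_form a A a1 b B k C b1 c in
  let aux := aux_form a A a1 b B k C b1 c in
  [/\ forall x : 'rV[F]_3, x != 0 ->
        (on_curve Q x <-> conic_lhs a A a1 B c x = 0),
      cubic != 0 -> equation_of G cubic,
      on_curve aux e /\ on_curve aux f
    & forall y : 'rV[F]_3, third_point aux e f y ->
        let z := (y *v c) *v (y *v a1 *v A *v a) in
        [/\ z != 0, on_curve Q z & on_curve G z]].
Proof.
have br j k l := @general_bracket F _ j k l general.
have abd : bracket a b d != 0 by apply: (br 0 1 3)%N.
have acb : bracket a c b != 0 by rewrite bracket_swap oppr_eq0; apply: (br 0 1 2)%N.
have bef : bracket b e f != 0 by apply: (br 1 4 5)%N.
have acd : bracket a c d != 0 by apply: (br 0 2 3)%N.
have ecd : bracket e c d != 0 by rewrite bracket_rot; apply: (br 2 3 4)%N.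
have aed : bracket a e d != 0 by rewrite bracket_swap oppr_eq0; apply: (br 0 3 4)%N.
have ace : bracket a c e != 0 by apply: (br 0 2 4)%N.
have fcd : bracket f c d != 0 by rewrite bracket_rot; apply: (br 2 3 5)%N.
have afd : bracket a f d != 0 by rewrite bracket_swap oppr_eq0; apply: (br 0 3 5)%N.
have acf : bracket a c f != 0 by apply: (br 0 2 5)%N.
have cfe : bracket c f e != 0 by rewrite bracket_swap oppr_eq0; apply: (br 2 4 5)%N.
have aef : bracket a e f != 0 by apply: (br 0 4 5)%N.
have def : bracket d e f != 0 by apply: (br 3 4 5)%N.
have [Q0 hQ] := conicQ; have [G0 hG] := cubicG.
have [q q0 QE] : exists2 l, l != 0 & forall x : 'rV[F]_3,
    Q.@[fun j => x 0 j] = l * ((f *v e) *d tau a (d *v e) ((a *v f) *v (d *v c)) c x).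
  by apply: conic_equation => //; apply: onQ; rewrite !inE eqxx ?orbT.
move=> A B a1 g1 h1 i1 g2 h2 i2 C u v K k b1 cubic aux.
have GE : cubic != 0 -> equation_of G cubic by apply: cubic_equation.
split=> //.
- move=> x _; rewrite conic_lhs_tau /on_curve QE; split=> [/eqP | ->]; last by rewrite mulr0.
  by rewrite mulf_eq0 (negPf q0) => /eqP.
- split; rewrite /on_curve eval_aux_form.
    by apply: aux_lhs_e; [exact: dot_cross_r | exact: dot_cross_r | exact: dot_cross_l].
  by apply: aux_lhs_f; exact: dot_cross_l.
move=> y y3 z.
have aux0 := third_point_neq0 y3; have auxy := third_point_on_curve y3.
case: y3 => [y0 [s [t [l [yE _ _]]]]].
have z0 : z != 0 by rewrite /z yE; apply: aux_point_neq0; rewrite -?yE.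
(* A third point exists only if [aux] is nonzero, and then [cubic] is nonzero by [aux_form_eq0]. *)
have [l' l'0 cubicE] : equation_of G cubic.
  by apply: GE; apply: contraNneq aux0 => c0; apply/eqP; apply: aux_form_eq0.
have tz : tau a A a1 c z = tau_aux_scale a A a1 c y *: y by exact: tau_aux_point.
split=> //.
- rewrite /on_curve QE tz dotZr.
  have -> : (f *v e) *d y = 0 by rewrite yE; coords.
  by rewrite !mulr0.
(* At [z] the form [cubic], a nonzero multiple of [G], is a scalar times the value of [aux] at [y],
   which is zero. *)
have := eval_cubic_form a A a1 b B k C b1 c z; rewrite -/cubic cubicE mevalZ.
rewrite [X in _ = X]cubic_aux_point -eval_aux_form -/aux auxy mulr0 => /eqP.
by rewrite mulf_eq0 (negPf l'0) => /eqP.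
Qed.
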